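(* Let $G=G^{(n)}$ be a sequence of finite virtually Abelian groups with $|G^{(n)}|\to\infty$, and let $H=H^{(n)}\trianglelefteq G^{(n)}$ be a sequence of normal Abelian subgroups such that $\sup_n|G^{(n)}|/|H^{(n)}|<\infty$. Let $k=k_n$ and $\mathcal S=\{Z_i^{\pm1}: i\in[k]\}$, where $Z_1,\dots,Z_k$ are i.i.d. uniform elements of $G$. If $k\gg\log|G|$ and $\log k\ll\log|G|$, then the simple random walk on $\mathrm{Cay}(G,\mathcal S)$ exhibits cutoff with high probability at time $$t_0(k,G)=\frac{\log|G|}{\log(k/\log|G|)}.$$
   Context: Asymptotic notation is along the sequence $n\to\infty$: $f\ll g$ (equivalently $g\gg f$) means $f/g\to0$. $[k]=\{1,\dots,k\}$. $\mathcal S$ is regarded as a multiset of size $2k$. The random walk $X=(X(t))_{t\ge0}$ on $\mathrm{Cay}(G,\mathcal S)$ is the continuous-time rate-1 walk: at the points of a rate-1 Poisson process, the current position is multiplied on the right by a uniformly chosen element of the multiset $\mathcal S$. $P_t$ is its transition kernel, $\pi$ is the uniform distribution on $G$, and $d_{\mathrm{TV}}(t)=\max_{x\in G}\|P_t(x,\cdot)-\pi\|_{\mathrm{TV}}$ (a random variable depending on $\mathcal S$). Cutoff at time $t_0$: for every fixed $\varepsilon>0$, $d_{\mathrm{TV}}((1-\varepsilon)t_0)=1-o(1)$ and $d_{\mathrm{TV}}((1+\varepsilon)t_0)=o(1)$ as $|G|\to\infty$ (the first for $\varepsilon<1$). ''With high probability'' refers to the random choice of $\mathcal S$: for every $\varepsilon$,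 $d_{\mathrm{TV}}((1-\varepsilon)t_0)\to1$ and $d_{\mathrm{TV}}((1+\varepsilon)t_0)\to0$ in probability. *)

(* Defs.v *)
From HB Require Import structures.
From mathcomp Require Import all_boot all_order all_algebra all_fingroup.
From mathcomp Require Import all_classical all_reals all_analysis.
Set Implicit Arguments.
Unset Strict Implicit.
Unset Printing Implicit Defensive.
Import Order.TTheory GRing.Theory Num.Theory.
Import numFieldNormedType.Exports.
Local Open Scope classical_set_scope.
Local Open Scope ring_scope.

(* f << g.  Division is total in MathComp (x / 0 = 0), so the quotient is also
   required to be meaningful for all large n. *)
Definition asymp_ll (R : realType) (f g : nat -> R) : Prop :=
  (\forall n \near \oo, g n != 0) /\ (f n / g n @[n --> \oo] --> (0 : R)).

Section RandomWalk.
Variables (R : realType) (gT : finGroupType).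

(* A multiset of group elements is represented by a sequence; its order is
   irrelevant below. *)

(* The multiset {Z_i^{+1}, Z_i^{-1} : i in [k]}, of size 2k. *)
Definition sym_gens (k : nat) (Z : {ffun 'I_k -> gT}) : seq gT :=
  [seq Z i | i : 'I_k] ++ [seq ((Z i)^-1)%g | i : 'I_k].

Definition step_kernel (S : seq gT) (x y : gT) : R :=
  (count (fun s => (x * s)%g == y) S)%:R / (size S)%:R.

Fixpoint steps_kernel (S : seq gT) (m : nat) (x y : gT) : R :=
  if m is m'.+1
  then \sum_(z : gT) steps_kernel S m' x z * step_kernel S z y
  else (x == y)%:R.

(* Transition kernel P_t of the continuous-time walk: the number of points in
   [0, t] of the rate-1 Poisson process is Poisson(t) distributed and
   independent of the steps, so P_t is the Poisson(t) mixture of the m-step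
   kernels.  The weights are spelled out because the library's poisson_pmf is
   the constant 1 at rate 0; here t = 0 gives the identity kernel. *)
Definition walk_kernel (S : seq gT) (t : R) (x y : gT) : R :=
  limn (series (fun m => expR (- t) * t ^+ m / m`!%:R * steps_kernel S m x y)).

Definition unif (x : gT) : R := #|gT|%:R^-1.

(* Total variation distance between two mass functions: the largest
   discrepancy |mu(A) - nu(A)| over the events A. *)
Definition tv_dist (mu nu : gT -> R) : R :=
  \big[Num.max/0]_(A : {set gT}) `|\sum_(x in A) mu x - \sum_(x in A) nu x|.

Definition d_TV (S : seq gT) (t : R) : R :=
  \big[Num.max/0]_(x : gT) tv_dist (walk_kernel S t x) unif.

(* Probability of an event when Z_1, ..., Z_k are i.i.d. uniform on gT. *)
Definition iid_unif_prob (k : nat) (E : pred {ffun 'I_k -> gT}) : R :=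
  \sum_(Z : {ffun 'I_k -> gT} | E Z) \prod_(i < k) unif (Z i).

End RandomWalk.

(* F_n -> l in probability, F_n being a function of k_n i.i.d. uniform elements
   of the n-th group. *)
Definition cvg_in_prob (R : realType) (gT : nat -> finGroupType) (k : nat -> nat)
    (F : forall n, {ffun 'I_(k n) -> gT n} -> R) (l : R) : Prop :=
  forall delta : R, 0 < delta ->
    iid_unif_prob R (fun Z : {ffun 'I_(k n) -> gT n} => delta < `|F n Z - l|)
      @[n --> \oo] --> (0 : R).

Definition cutoff_whp (R : realType) (gT : nat -> finGroupType) (k : nat -> nat)
    (t0 : nat -> R) : Prop :=
  forall eps : R, 0 < eps ->
    (eps < 1 ->
      cvg_in_prob (fun n (Z : {ffun 'I_(k n) -> gT n}) =>
        d_TV (sym_gens Z) ((1 - eps) * t0 n)) 1) /\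
    cvg_in_prob (fun n (Z : {ffun 'I_(k n) -> gT n}) =>
      d_TV (sym_gens Z) ((1 + eps) * t0 n)) 0.

Definition cutoff_time (R : realType) (k N : nat) : R :=
  ln N%:R / ln (k%:R / ln N%:R).

(* Main.v *)
Require Import Defs.
From HB Require Import structures.
From mathcomp Require Import all_boot all_order all_algebra all_fingroup.
From mathcomp Require Import all_classical all_reals all_analysis.
From mathcomp Require Import ring lra.
Set Implicit Arguments.
Unset Strict Implicit.
Unset Printing Implicit Defensive.
Import Order.TTheory GRing.Theory Num.Theory.
Import numFieldNormedType.Exports.
Local Open Scope classical_set_scope.
Local Open Scope ring_scope.

(* Write N = |G|, and let m be the number of steps of the walk, which is Poisson
   and hence concentrated around t.

   Upper bound, for any group: by Cauchy-Schwarz and reversibility the squared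
   distance to uniformity after q steps is at most N p_2q(1,1) - 1.  A word of
   length 2q in which some generator occurs exactly once has a uniform value, so
   it contributes nothing in expectation over the generators; any other word uses
   at most q generators, which has probability at most
   C(k,q) (q/k)^(2q) <= (e q/k)^q.  This is o(1/N) for q = (1 + eps/2) t_0.

   Lower bound, for every choice of generators: by Schreier's rewriting a word of
   length m is a coset representative times a product of m elements among
   O(k) elements of the abelian subgroup H, and such a product only depends on
   the multiset of its factors.  Hence at most O(1) C(m + O(k), m) elements are
   reached, which is o(N) for m <= (1 - eps/2) t_0. *)

(** * Discrete-time walk: contraction, reversibility, second moment *)

Section DiscreteWalk.
Variables (R : realType) (gT : finGroupType) (S : seq gT).
Hypothesis S_gt0 : (0 < size S)%N.
Implicit Types x y z : gT.
Notation K := (step_kernel R S).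
Notation P := (steps_kernel R S).

Lemma step_kernelE x y :
  K x y = (\sum_(s <- S) ((x * s)%g == y)%:R) / (size S)%:R.
Proof.
rewrite /step_kernel -sum1_count natr_sum big_mkcond; congr (_ / _).
by apply: eq_bigr => s _; case: eqP.
Qed.

Lemma step_kernel_ge0 x y : 0 <= K x y.
Proof. by rewrite divr_ge0. Qed.

Lemma sum_step_kernel x (F : gT -> R) :
  \sum_y K x y * F y = (\sum_(s <- S) F (x * s)%g) / (size S)%:R.
Proof.
under eq_bigr do rewrite step_kernelE mulrAC mulr_suml.
rewrite -mulr_suml exchange_big; congr (_ / _); apply: eq_bigr => s _.
rewrite (bigD1 (x * s)%g) //= eqxx mul1r big1 ?addr0 // => y.
by rewrite eq_sym => /negPf ->; rewrite mul0r.
Qed.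

Lemma sum_step_kernel1 x : \sum_y K x y = 1.
Proof.
have := sum_step_kernel x (fun=> 1); under eq_bigr do rewrite mulr1.
by move=> ->; rewrite big_const_seq count_predT iter_addr_0 divff // pnatr_eq0 -lt0n.
Qed.

Lemma sum_step_kernelr y (F : gT -> R) :
  \sum_x F x * K x y = (\sum_(s <- S) F (y * s^-1)%g) / (size S)%:R.
Proof.
under eq_bigr do rewrite step_kernelE mulrA mulr_sumr.
rewrite -mulr_suml exchange_big; congr (_ / _); apply: eq_bigr => s _.
rewrite (bigD1 (y * s^-1)%g) //= mulgKV eqxx mulr1 big1 ?addr0 // => x.
by rewrite -(inj_eq (mulIg s)) mulgKV => /negPf ->; rewrite mulr0.
Qed.

Lemma steps_kernel_ge0 m x y : 0 <= P m x y.
Proof.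
elim: m y => [|m IH] y /=; first by rewrite ler0n.
by apply: sumr_ge0 => z _; rewrite mulr_ge0 ?step_kernel_ge0.
Qed.

Lemma sum_steps_kernel m x : \sum_y P m x y = 1.
Proof.
elim: m => [|m IH] /=.
  rewrite (bigD1 x) //= eqxx big1 ?addr0 // => y.
  by rewrite eq_sym => /negPf ->.
rewrite exchange_big /= -IH; apply: eq_bigr => z _.
rewrite -mulr_sumr -[in RHS](mulr1 (P m x z)); congr (_ * _).
exact: sum_step_kernel1.
Qed.

Lemma steps_kernel_le1 m x y : P m x y <= 1.
Proof.
rewrite -(sum_steps_kernel m x) (bigD1 y) //= lerDl.
by apply: sumr_ge0 => z _; exact: steps_kernel_ge0.
Qed.

(** Twice the total variation distance to uniformity. *)
Definition l1_dist m x : R := \sum_y `|P m x y - unif R y|.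

(** The kernel fixes the uniform law, since right multiplication permutes the group, and it
    contracts the l1 norm. A bound at one step count thus covers all later terms of the Poisson
    mixture. *)
Lemma l1_dist_nincr m p x : (m <= p)%N -> l1_dist p x <= l1_dist m x.
Proof.
move=> /subnKC <-; elim: (p - m)%N => [|q IH]; first by rewrite addn0.
rewrite addnS; apply: le_trans IH; set r := (m + q)%N.
rewrite /l1_dist /=.
apply: (@le_trans _ _ (\sum_y \sum_z `|P r x z - unif R z| * K z y)).
  apply: ler_sum => y _.
  have -> : unif R y = \sum_z unif R z * K z y.
    rewrite sum_step_kernelr big_const_seq count_predT iter_addr_0 /unif.
      by rewrite -[X in X / _]mulr_natr mulfK // pnatr_eq0 -lt0n.
  rewrite -sumrB; apply: le_trans (ler_norm_sum _ _ _) _.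
  apply: ler_sum => z _.
  by rewrite -mulrBl normrM [`|K z y|]ger0_norm ?step_kernel_ge0.
rewrite exchange_big /=; apply: ler_sum => z _.
by rewrite -mulr_sumr sum_step_kernel1 mulr1.
Qed.

Lemma steps_kernelD m p x y : P (m + p) x y = \sum_z P m x z * P p z y.
Proof.
elim: p y => [|p IH] y.
  rewrite addn0 (bigD1 y) //= eqxx mulr1 big1 ?addr0 // => z /negPf.
  by move=> ->; rewrite mulr0.
rewrite addnS /=; under eq_bigr do rewrite IH mulr_suml.
rewrite exchange_big; apply: eq_bigr => z _ /=.
by rewrite mulr_sumr; apply: eq_bigr => w _; rewrite mulrA.
Qed.

Hypothesis S_sym : forall s, count_mem (s^-1)%g S = count_mem s S.

Lemma step_kernel_sym x y : K x y = K y x.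
Proof.
have E u v : (count (fun s => (u * s)%g == v) S = count_mem (u^-1 * v)%g S).
  by apply: eq_count => s /=; rewrite -(inj_eq (mulgI u^-1)%g) mulKg.
by rewrite /step_kernel !E -S_sym invMg invgK.
Qed.

Lemma steps_kernel_sym m x y : P m x y = P m y x.
Proof.
elim: m x y => [|m IH] x y; first by rewrite /= eq_sym.
rewrite [RHS](_ : _ = P (1 + m) y x) // steps_kernelD /=.
apply: eq_bigr => z _; rewrite IH mulrC (step_kernel_sym z); congr (_ * _).
rewrite (bigD1 y) //= eqxx mul1r big1 ?addr0 // => w.
by rewrite eq_sym => /negPf ->; rewrite mul0r.
Qed.

(** Symmetry turns each [P m x y ^+ 2] into a return to [x] through [y], and these add up to
    [P (m + m) x x]. *)
Lemma sum_sqr_dev m x :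
  \sum_y (P m x y - unif R y) ^+ 2 = P (m + m) x x - #|gT|%:R^-1.
Proof.
rewrite steps_kernelD.
have N0 : #|gT|%:R != 0 :> R by rewrite pnatr_eq0 -lt0n; apply/card_gt0P; exists x.
transitivity (\sum_y (P m x y * P m y x - P m x y * (#|gT|%:R^-1 *+ 2) +
  #|gT|%:R^-1 ^+ 2)).
  apply: eq_bigr => y _; rewrite /unif (steps_kernel_sym m y x); ring.
rewrite big_split /= sumrB -mulr_suml sum_steps_kernel sumr_const.
rewrite -mulr_natr; field.
by [].
Qed.

(** Cauchy-Schwarz in linearised form: AM-GM with a free parameter [c], which avoids square roots.
    Later [c] is half of the tolerance [delta]. *)
Lemma l1_dist_le m x (c : R) : 0 < c ->
  l1_dist m x <= c / 2 + (#|gT|%:R * P (m + m) x x - 1) / (2 * c).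
Proof.
move=> c0; set N := #|gT|%:R.
have N0 : 0 < N :> R by rewrite ltr0n; apply/card_gt0P; exists x.
apply: (@le_trans _ _ (\sum_y (c / (2 * N) +
    N / (2 * c) * (P m x y - unif R y) ^+ 2))).
  apply: ler_sum => y _; set u := _ - _.
  rewrite -(real_normK (num_real u)); set v := `|u|.
  (* This square is exactly the difference of the two sides. *)
  have : 0 <= (v * N - c) ^+ 2 / (2 * c * N).
    by rewrite divr_ge0 ?sqr_ge0 // !mulr_ge0 // ltW.
  rewrite -subr_ge0; congr (0 <= _); field.
  by rewrite !gt_eqF.
rewrite big_split /= sumr_const -mulr_sumr sum_sqr_dev -[_ *+ _]mulr_natr -/N.
by rewrite le_eqVlt; apply/orP; left; apply/eqP; field; rewrite !gt_eqF.
Qed.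

End DiscreteWalk.

(** * Poisson mixtures and their exponential tails *)

Section PoissonMixture.
Variable R : realType.
Implicit Types (t : R) (a b : nat -> R).

Definition pois t (m : nat) : R := expR (- t) * t ^+ m / m`!%:R.

(** The expectation of [a] at a Poisson(t) variable, with the weights of [walk_kernel], so that the
    kernel is an instance by unfolding. *)
Definition pois_mix t a : R := limn (series (fun m => pois t m * a m)).

Lemma pois_ge0 t m : 0 <= t -> 0 <= pois t m.
Proof. by move=> t0; rewrite !mulr_ge0 ?expR_ge0 ?exprn_ge0. Qed.

Lemma pois_geomE t q :
  (fun m => pois t m * q ^+ m) = expR (- t) *: exp_coeff (t * q).
Proof.
apply/funext => m; change (expR (- t) * t ^+ m / m`!%:R * q ^+ m =
  expR (- t) * ((t * q) ^+ m / m`!%:R)).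
by rewrite exprMn -!mulrA; congr (_ * (_ * _)); rewrite mulrC.
Qed.

Lemma is_cvg_pois_geom t q :
  cvgn (series (fun m => pois t m * q ^+ m)).
Proof. by rewrite pois_geomE; apply: is_cvg_seriesZ; exact: is_cvg_series_exp_coeff. Qed.

(** The probability generating function of the Poisson law: [q = 1] gives total mass one, other [q]
    give the tail bounds. *)
Lemma pois_mix_geom t q :
  pois_mix t (fun m => q ^+ m) = expR (t * (q - 1)).
Proof.
rewrite /pois_mix pois_geomE lim_seriesZ; last exact: is_cvg_series_exp_coeff.
rewrite -[limn _]/(expR (t * q)) [LHS](_ : _ = expR (- t) * expR (t * q)) //.
by rewrite -expRD; congr expR; ring.
Qed.

Lemma is_cvg_pois_mix t a : 0 <= t -> (forall m, `|a m| <= 1) ->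
  cvgn (series (fun m => pois t m * a m)).
Proof.
move=> t0 a1; apply: normed_cvg.
have := @is_cvg_pois_geom t 1; apply: series_le_cvg => m /=.
- exact: normr_ge0.
- by rewrite expr1n mulr1 pois_ge0.
by rewrite normrM ger0_norm ?pois_ge0 // expr1n ler_wpM2l ?pois_ge0.
Qed.

Lemma pois_mix_le t a b : 0 <= t ->
  cvgn (series (fun m => pois t m * a m)) ->
  cvgn (series (fun m => pois t m * b m)) ->
  (forall m, a m <= b m) -> pois_mix t a <= pois_mix t b.
Proof.
move=> t0 ca cb ab; apply: lim_series_le => // m.
by rewrite ler_wpM2l ?pois_ge0.
Qed.

Lemma is_cvg_pois_cst t c : cvgn (series (fun m => pois t m * c)).
Proof.
rewrite (_ : (fun _ => _) = c *: (fun m => pois t m * 1 ^+ m)).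
  by apply: is_cvg_seriesZ; exact: is_cvg_pois_geom.
apply/funext => m; change (pois t m * c = c * (pois t m * 1 ^+ m)).
by rewrite expr1n mulr1 mulrC.
Qed.

Lemma pois_mix1 t : pois_mix t (fun=> 1) = 1.
Proof.
rewrite (_ : (fun=> 1) = fun m => 1 ^+ m).
  by rewrite pois_mix_geom subrr mulr0 expR0.
by apply/funext => m; rewrite expr1n.
Qed.

Lemma pois_mix_cst t c : pois_mix t (fun=> c) = c.
Proof.
rewrite /pois_mix (_ : (fun _ => _) = c *: (fun m => pois t m * 1 ^+ m)).
  rewrite lim_seriesZ; last exact: is_cvg_pois_geom.
  rewrite -[limn _]/(pois_mix t _) pois_mix_geom subrr mulr0 expR0.
  exact: mulr1.
apply/funext => m; change (pois t m * c = c * (pois t m * 1 ^+ m)).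
by rewrite expr1n mulr1 mulrC.
Qed.

Lemma is_cvg_pois_mixD t a b :
  cvgn (series (fun m => pois t m * a m)) ->
  cvgn (series (fun m => pois t m * b m)) ->
  cvgn (series (fun m => pois t m * (a m + b m))).
Proof.
move=> ca cb; have := is_cvg_seriesD ca cb.
rewrite (_ : _ + _ = fun m => pois t m * (a m + b m)) //.
by apply/funext => m; rewrite mulrDr.
Qed.

Lemma pois_mixD t a b :
  cvgn (series (fun m => pois t m * a m)) ->
  cvgn (series (fun m => pois t m * b m)) ->
  pois_mix t (fun m => a m + b m) = pois_mix t a + pois_mix t b.
Proof.
move=> ca cb; rewrite /pois_mix -lim_seriesD //; congr (limn (series _)).
by apply/funext => m; rewrite mulrDr.
Qed.

Lemma pois_mixB t a b :
  cvgn (series (fun m => pois t m * a m)) ->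
  cvgn (series (fun m => pois t m * b m)) ->
  pois_mix t (fun m => a m - b m) = pois_mix t a - pois_mix t b.
Proof.
move=> ca cb; rewrite /pois_mix -lim_seriesB //; congr (limn (series _)).
by apply/funext => m; rewrite mulrBr.
Qed.

Lemma pois_mix_sum (I : finType) (A : {set I}) t (a : I -> nat -> R) :
  (forall i, cvgn (series (fun m => pois t m * a i m))) ->
  pois_mix t (fun m => \sum_(i in A) a i m) = \sum_(i in A) pois_mix t (a i).
Proof.
move=> ca.
rewrite -!big_enum /=; under eq_fun do rewrite -big_enum /=.
have cs (s : seq I) : cvgn (series (fun m => pois t m * \sum_(i <- s) a i m)).
  rewrite (_ : (fun m => _) = \sum_(i <- s) (fun m => pois t m * a i m)).
    apply: (big_ind (fun f => cvgn (series f))) => //.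
      have := @is_cvg_seriesZ _ _ 0 (@is_cvg_pois_geom t 1).
      by rewrite scale0r.
    by move=> f g; exact: is_cvg_seriesD.
  by apply/funext => m; rewrite mulr_sumr fct_sumE.
elim: (enum A) => [|i s IH].
  by under eq_fun do rewrite big_nil; rewrite pois_mix_cst big_nil.
rewrite big_cons -IH -pois_mixD //.
by under eq_fun do rewrite big_cons.
Qed.

(** The large-deviation rate of a Poisson variable at [q] times its mean, per unit of mean. *)
Definition tilt_rate (q : R) : R := q * ln q - q + 1.

(** The strict inequality [1 + u < expR u] at [u = - ln q], multiplied by [q]. *)
Lemma tilt_rate_gt0 q : 0 < q -> q != 1 -> 0 < tilt_rate q.
Proof.
move=> q0 q1.
have : 1 + - ln q < expR (- ln q).
  apply: expR_gt1Dx; rewrite oppr_eq0; apply: contra q1 => /eqP h.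
  by rewrite -(lnK (x := q)) ?posrE // h expR0.
rewrite expRN lnK ?posrE // => h.
have : q * (1 + - ln q) < q * q^-1 by rewrite ltr_pM2l.
rewrite mulfV ?gt_eqF // /tilt_rate; lra.
Qed.

(* Exponential tilting: [q ^ (m - q t) >= 1] on [A], so the indicator of [A] is
   dominated by a geometric sequence, whose Poisson mean is explicit. *)
Lemma pois_tail t q (A : pred nat) : 0 < t -> 0 < q ->
  (forall m, A m -> 0 <= (m%:R - q * t) * ln q) ->
  pois_mix t (fun m => (A m)%:R) <= expR (- (tilt_rate q * t)).
Proof.
move=> t0 q0 hA.
set c := expR (- (q * t * ln q)).
have -> : expR (- (tilt_rate q * t)) = pois_mix t (fun m => c * q ^+ m).
  rewrite /pois_mix.
  rewrite (_ : (fun _ => _) = c *: (fun m => pois t m * q ^+ m)).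
    rewrite lim_seriesZ; last exact: is_cvg_pois_geom.
    rewrite -[limn _]/(pois_mix t _) pois_mix_geom.
    rewrite [RHS](_ : _ = c * expR (t * (q - 1))) // -expRD; congr expR.
    by rewrite /tilt_rate; ring.
  by apply/funext => m; exact: mulrCA.
apply: pois_mix_le; first exact: ltW.
- by apply: is_cvg_pois_mix => [|m]; [exact: ltW|case: (A m); rewrite ?normr1 ?normr0].
- rewrite (_ : (fun _ => _) = c *: (fun m => pois t m * q ^+ m)).
    by apply: is_cvg_seriesZ; exact: is_cvg_pois_geom.
  by apply/funext => m; exact: mulrCA.
move=> m; case: (boolP (A m)) => [Am|_] /=; last first.
  by rewrite mulr_ge0 ?expR_ge0 ?exprn_ge0 // ltW.
have -> : c * q ^+ m = expR ((m%:R - q * t) * ln q).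
  by rewrite mulrBl expRD expRM_natl lnK ?posrE // mulrC.
by rewrite -[leLHS]expR0 ler_expR hA.
Qed.

End PoissonMixture.

(** * Counting group elements reached by short words *)

Section BallGrowth.
Local Open Scope group_scope.
Variable gT : finGroupType.

(** A product either avoids [a] or, as [a] commutes with the other factors, can be rewritten with
    [a] in front. This is the set form of Pascal's rule. *)
Lemma expg_setU1_subset (a : gT) (A : {set gT}) m :
  {in A, forall b, commute a b} ->
  (a |: A) ^+ m.+1 \subset A ^+ m.+1 :|: a *: ((a |: A) ^+ m).
Proof.
move=> aA; elim: m => [|m IH].
  rewrite !expg1 expg0 mulg1 finset.setUC; apply/fintype.subsetP => x.
  by rewrite !inE.
rewrite expgSr; apply/fintype.subsetP => _ /mulsgP[y b yB + ->].
move/(fintype.subsetP IH): yB => /setUP[yA|]; last first.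
  case/lcosetP=> z zB -> bB; apply/setUP; right; apply/lcosetP.
  by exists (z * b); rewrite ?mulgA // expgSr mem_mulg.
case/setU1P=> [->|bA]; apply/setUP; last by left; rewrite expgSr mem_mulg.
right; apply/lcosetP; exists y.
  apply: (fintype.subsetP _ _ yA); elim: m.+1 {IH yA} => [|n IH]; first by rewrite !expg0.
  by rewrite !expgS mulgSS // finset.subsetUr.
have : commute a y; last by [].
elim: m.+1 y yA {IH} => [|n IH] y; first by rewrite expg0 => /set1P->; exact: commute1.
by rewrite expgSr => /mulsgP[u v uA vA ->]; apply: commuteM; [exact: IH|exact: aA].
Qed.

(** Stars and bars through Pascal's rule, by induction on [n] and then on [m]. Using [m + n] instead
    of the sharp [m + n - 1] keeps [n = 0] uniform. *)
Lemma card_commuting_power (A : {set gT}) n m :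
  {in A &, forall a b, commute a b} -> (#|A| <= n)%N ->
  (#|A ^+ m| <= 'C(m + n, m))%N.
Proof.
elim: n A m => [|n IHn] A m cA; first rewrite leqn0 cards_eq0 => /eqP->.
  case: m => [|m]; first by rewrite expg0 cards1 bin0.
  by rewrite expgS mul0g cards0.
have [->|] := eqVneq A finset.set0.
  case: m => [|m] _; first by rewrite expg0 cards1 bin0.
  by rewrite expgS mul0g cards0.
case/set0Pn => a aA An.
have cA' : {in A :\ a &, forall a b, commute a b}.
  by move=> x y /setD1P[_ xA] /setD1P[_ yA]; exact: cA.
have An' : (#|A :\ a| <= n)%N by move: An; rewrite (cardsD1 a) aA.
elim: m => [|m IHm]; first by rewrite expg0 cards1 bin0.
have aA' : {in A :\ a, forall b, commute a b} by move=> b /setD1P[_]; exact: cA.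
have := expg_setU1_subset m aA'; rewrite finset.setD1K // => /subset_leq_card /leq_trans.
apply; apply: (leq_trans (leq_card_setU _ _)).
rewrite addSn binS leq_add //; first by rewrite addnS -addSn IHn.
by rewrite card_lcoset.
Qed.

(* Schreier's argument: with [rep] a choice of representatives of the cosets of
   [H], a word [s_1 ... s_j] equals the product of the elements
   [r_i s_i (rep (r_i s_i))^-1] of [H], where [r_i = rep (s_1 ... s_(i-1))],
   followed by a coset representative.  There are at most [|G : H| * size S] such
   elements of [H]; [1] is added to them so that shorter words are covered. *)
Lemma short_words_card (H : {group gT}) (S : seq gT) m : abelian H ->
  (exists B : {set gT}, [/\
    forall w : seq gT, (size w <= m)%N -> {subset w <= S} ->
      \prod_(a <- w) a \in B &
    (#|B| <= #|[set: gT]%G : H| * 'C(m + (#|[set: gT]%G : H| * (size S)).+1, m))%N]).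
Proof.
move=> cHH; set G := [set: gT]%G.
pose rep x := repr (H :* x).
have repE x : rep x \in H :* x by exact: mem_repr_rcoset.
have repH x : x * (rep x)^-1 \in H.
  by have /rcosetP[h hH ->] := repE x; rewrite invMg mulKVg groupV.
pose R := rep @: G.
have cR : (#|R| <= #|G : H|)%N.
  have -> : R = (@repr gT) @: rcosets H G.
    apply/finset.setP => y; apply/imsetP/imsetP => [[x _ ->]|[C]].
      by exists (H :* x) => //; apply/rcosetsP; exists x; rewrite ?inE.
    by case/rcosetsP => x _ -> ->; exists x; rewrite ?inE.
  exact: leq_imset_card.
pose A0 := (fun r : gT * gT => r.1 * r.2 * (rep (r.1 * r.2))^-1) @: finset.setX R (finset.finset (mem S)).
pose A := 1 |: A0.
have AH : A \subset H.
  apply/fintype.subsetP => x /setU1P[->|/imsetP[r _ ->]]; first exact: group1.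
  exact: repH.
have cA : (#|A| <= (#|G : H| * size S).+1)%N.
  rewrite cardsU1 -addn1 addnC leq_add ?leq_b1 //.
  apply: leq_trans (leq_imset_card _ _) _; rewrite cardsX leq_mul //.
  by rewrite cardsE card_size.
have A1 : 1 \in A by rewrite setU11.
exists (A ^+ m * R); split => [w wm wS|]; last first.
  rewrite mulnC; apply: leq_trans (leq_mul (card_commuting_power m _ cA) cR).
    by rewrite -[A ^+ m * R]/(set_mulg _ _) /set_mulg curry_imset2X -cardsX leq_imset_card.
  by move=> a b aA bA; apply: (centsP cHH); exact: (fintype.subsetP AH).
have mono j : (j <= m)%N -> A ^+ j \subset A ^+ m.
  move=> /subnKC <-; elim: (m - j)%N => [|i IH]; first by rewrite addn0.
  rewrite addnS expgSr; apply: (fintype.subset_trans IH).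
  by rewrite -{1}[A ^+ (j + i)]mulg1 mulgS // finset.sub1set.
apply: (fintype.subsetP (mulSg _ (mono _ wm))).
elim/last_ind: w wS {wm} => [|w s IH] wS.
  rewrite big_nil expg0 mul1g; apply/imsetP; exists 1; rewrite ?inE //.
  by rewrite /rep mulg1 repr_group.
rewrite big_rcons size_rcons expgSr.
have /mulsgP[a r aA rR ->] : \prod_(i <- w) i \in A ^+ size w * R.
  by apply: IH => x xw; apply: wS; rewrite mem_rcons inE xw orbT.
apply/mulsgP; exists (a * (r * s * (rep (r * s))^-1)) (rep (r * s)).
- rewrite mem_mulg //; apply/setU1P; right; apply/imsetP; exists (r, s) => //.
  apply/setXP; split=> /=; first exact: rR.
  by rewrite inE; apply: wS; rewrite mem_rcons mem_head.
- by rewrite imset_f ?inE.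
- by rewrite !mulgA mulgKV.
Qed.

End BallGrowth.

(** * Step distributions as averages over words *)

Section Words.
Variables (R : realType) (T : eqType).
Implicit Types (l w : seq T).

(** Letters are appended on the right, as in the recursion of [steps_kernel]; a sequence of words
    makes repeated letters count with multiplicity. *)
Fixpoint words l m : seq (seq T) :=
  if m is m'.+1 then [seq rcons w a | w <- words l m', a <- l] else [:: [::]].

Lemma big_words l m (F : seq T -> R) :
  \sum_(w <- words l m.+1) F w = \sum_(w <- words l m) \sum_(a <- l) F (rcons w a).
Proof. by rewrite /= big_flatten big_map; apply: eq_bigr => w _; rewrite big_map. Qed.

Lemma wordsP l m w : w \in words l m -> size w = m /\ {subset w <= l}.
Proof.
elim: m w => [|m IH] w /=; first by rewrite inE => /eqP->.
case/allpairsP => -[u a] /= [/IH[su ul] al ->]; rewrite size_rcons su.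
by split=> // b; rewrite mem_rcons inE => /orP[/eqP->|/ul].
Qed.

Lemma sum_words_all (p : pred T) l m :
  \sum_(w <- words l m) (all p w)%:R = ((count p l) ^ m)%:R :> R.
Proof.
elim: m => [|m IH]; first by rewrite big_seq1.
rewrite big_words expnSr natrM -IH mulr_suml; apply: eq_bigr => w _.
under eq_bigr do rewrite all_rcons andbC -mulnb natrM.
rewrite -mulr_sumr; congr (_ * _).
by rewrite -sum1_count natr_sum [RHS]big_mkcond; apply: eq_bigr => a _; case: (p a).
Qed.

Lemma sum_words1 l m : \sum_(w <- words l m) 1 = (size l)%:R ^+ m :> R.
Proof.
rewrite -natrX -count_predT -sum_words_all; apply: eq_bigr => w _.
by rewrite all_predT.
Qed.

(** The words are over abstract letters valued by [f], so one index set serves all choices of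
    generators and the average over them can be taken word by word. *)
Lemma steps_kernel_words (gT : finGroupType) (f : T -> gT) l m x y :
  steps_kernel R (map f l) m x y =
  (\sum_(w <- words l m) ((x * \prod_(a <- w) f a)%g == y)%:R) / (size l)%:R ^+ m.
Proof.
elim: m y => [|m IH] y.
  by rewrite /= big_seq1 big_nil mulg1 expr0 divr1.
rewrite big_words /=.
under eq_bigr do rewrite IH mulrAC mulr_suml.
rewrite -mulr_suml exchange_big /= exprSr invfM [_^-1 * _^-1]mulrC.
rewrite [RHS]mulrA; congr (_ / _); rewrite mulr_suml; apply: eq_bigr => w _.
rewrite (bigD1 (x * \prod_(a <- w) f a)%g) //= eqxx mul1r.
rewrite [X in _ + X]big1 => [|z]; last first.
  by rewrite eq_sym => /negPf ->; rewrite mul0r.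
rewrite addr0 step_kernelE big_map size_map; congr (_ / _).
by apply: eq_bigr => a _; rewrite big_rcons mulgA.
Qed.

End Words.

(** * Return probability averaged over the random generators *)

Section RandomGenerators.
Variables (R : realType) (gT : finGroupType) (k : nat).
Notation letter := ('I_k * bool)%type.
Implicit Types (Z : {ffun 'I_k -> gT}) (w : seq letter).

(** Signed indices in place of group elements: a word then records which generators occur, whatever
    [Z] is. *)
Definition letters : seq letter :=
  [seq (i, true) | i : 'I_k] ++ [seq (i, false) | i : 'I_k].

Definition letter_val Z (a : letter) : gT := if a.2 then Z a.1 else (Z a.1)^-1%g.

Lemma sym_gensE Z : sym_gens Z = map (letter_val Z) letters.
Proof. by rewrite /sym_gens /letters map_cat /image_mem -!map_comp. Qed.

Lemma size_letters : size letters = (2 * k)%N.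
Proof. by rewrite size_cat !size_image card_ord mul2n addnn. Qed.

Lemma size_sym_gens Z : size (sym_gens Z) = (2 * k)%N.
Proof. by rewrite sym_gensE size_map size_letters. Qed.

Lemma sym_gens_inv Z s : count_mem (s^-1)%g (sym_gens Z) = count_mem s (sym_gens Z).
Proof.
rewrite /sym_gens !count_cat !count_map addnC.
by congr (_ + _)%N; apply: eq_count => i /=; rewrite ?(inj_eq invg_inj) // eqg_invLR.
Qed.

Lemma count_letters (D : {set 'I_k}) :
  count (fun a : letter => a.1 \in D) letters = (2 * #|D|)%N.
Proof.
have E : count (mem D) (enum 'I_k) = #|D| by rewrite cardE size_filter enumT.
by rewrite count_cat !count_map mul2n -addnn -E enumT.
Qed.

Lemma sum_inj_eq (T : finType) (h : T -> T) y : injective h ->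
  \sum_x (h x == y)%:R = 1 :> R.
Proof.
move=> hI; transitivity (\sum_x (x == y)%:R : R).
  by rewrite [RHS](reindex_inj hI).
by rewrite (bigD1 y) //= eqxx big1 ?addr0 // => x /negPf ->.
Qed.

(* Multiplying [Z i] by an independent uniform element does not change the law
   of [Z], and makes the value of a word containing [i] exactly once uniform. *)
Lemma word_uniform w (i : 'I_k) : count (fun a : letter => a.1 == i) w = 1%N ->
  #|gT|%:R * \sum_Z ((\prod_(a <- w) letter_val Z a)%g == 1%g)%:R
    = #|{ffun 'I_k -> gT}|%:R :> R.
Proof.
move=> wi.
have [w1 [b [w2 [-> w1i w2i]]]] : exists w1 b w2, [/\ w = w1 ++ (i, b) :: w2,
    all (fun a => a.1 != i) w1 & all (fun a => a.1 != i) w2].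
  elim: w wi => // -[j b] w IH /=; have [<-|ji] := eqVneq j i.
    move=> [/eqP]; rewrite -leqn0 leqNgt -has_count -all_predC => h.
    by exists [::], b, w.
  move=> /IH[w1 [c [w2 [-> h1 h2]]]].
  by exists ((j, b) :: w1), c, w2; rewrite /= ji.
pose upd g Z : {ffun 'I_k -> gT} := [ffun j => if j == i then (Z j * g)%g else Z j].
have updI g : injective (upd g).
  move=> Z Z' /ffunP e; apply/ffunP => j; have := e j; rewrite !ffunE.
  by case: ifP => // _ /mulIg.
have updE g Z v : all (fun a : letter => a.1 != i) v ->
    (\prod_(a <- v) letter_val (upd g Z) a = \prod_(a <- v) letter_val Z a)%g.
  move=> /allP vi; apply: eq_big_seq => a /vi ai.
  by rewrite /letter_val ffunE (negPf ai).
transitivity (\sum_(Z : {ffun 'I_k -> gT}) (1 : R)); last by rewrite sumr_const.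
(* Average over the shift [g] in coordinate [i]: for each fixed [Z] the value of the word is
   injective in [g], so exactly one [g] makes it 1. *)
transitivity (\sum_(g : gT) \sum_Z
    ((\prod_(a <- w1 ++ (i, b) :: w2) letter_val (upd g Z) a)%g == 1%g)%:R : R).
  rewrite mulr_natl -sumr_const; apply: eq_bigr => g _.
  exact: (reindex_inj (updI g)).
rewrite exchange_big; apply: eq_bigr => Z _ /=.
under eq_bigr do rewrite big_cat big_cons /= !updE //.
apply: (@sum_inj_eq _ (fun g => _ * (letter_val (upd g Z) (i, b) * _))%g) => g g'.
move=> /mulgI /mulIg; rewrite /letter_val /= !ffunE eqxx.
by case: b => [/mulgI|/invg_inj /mulgI].
Qed.

Lemma subset_extend (A : {set 'I_k}) q : (#|A| <= q <= k)%N ->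
  exists2 D : {set 'I_k}, A \subset D & #|D| = q.
Proof.
case/andP=> Aq; elim: q Aq => [|q IH].
  by rewrite leqn0 => /eqP A0; exists A.
rewrite leq_eqVlt => /orP[/eqP Aq _|Aq qk]; first by exists A.
have [D AD cD] := IH Aq (ltnW qk).
have /fintype.subsetPn[i _ iD] : ~~ ([set: 'I_k]%SET \subset D).
  apply/negP => /subset_leq_card; rewrite cardsT card_ord cD.
  by rewrite leqNgt qk.
exists (i |: D); first exact: (fintype.subset_trans AD (finset.subsetUr _ _)).
by rewrite cardsU1 iD cD.
Qed.

(** Every index that occurs takes at least two of the [q + q] letters, so at most [q] occur. Padding
    to exactly [q] lets the union bound run over ['C(k, q)] sets of equal size. *)
Lemma word_few_indices w q : (q <= k)%N -> size w = (q + q)%N ->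
  (forall i, count (fun a : letter => a.1 == i) w != 1%N) ->
  exists2 D : {set 'I_k}, #|D| = q & all (fun a => a.1 \in D) w.
Proof.
move=> qk sw w1.
pose A := finset.finset (mem (map fst w)).
have szE : size w = (\sum_i count (fun a : letter => a.1 == i) w)%N.
  elim: (w) => [|a v IH] /=; first by rewrite big1.
  rewrite big_split /= -IH (bigD1 a.1) //= eqxx big1 ?addn0 // => i.
  by rewrite eq_sym => /negPf ->.
have Aq : (#|A| <= q)%N.
  rewrite -leq_double -!addnn -sw szE -sum1_card addnn -mul2n big_distrr /=.
  rewrite big_mkcond leq_sum // => i _; rewrite inE muln1.
  case: ifP => // /mapP[a aw ->]; move: (w1 a.1).
  have : (0 < count (fun b => b.1 == a.1) w)%N.
    by rewrite -has_count; apply/hasP; exists a.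
  by case: count => [|[]].
have [|D AD cD] := @subset_extend A q; first by rewrite Aq.
exists D => //; apply/allP => a aw; apply: (fintype.subsetP AD).
rewrite inE; exact: map_f.
Qed.

(** A word with an index occurring once returns with probability exactly [1 / |G|]. Any other word
    is bounded by 1 and lies over some [q]-set of indices; each such set supports a fraction
    [(q/k)^(2q)] of all words. *)
Lemma sum_return_prob q : (q <= k)%N -> (0 < k)%N ->
  \sum_(Z : {ffun 'I_k -> gT}) steps_kernel R (sym_gens Z) (q + q) 1%g 1%g <=
    #|{ffun 'I_k -> gT}|%:R *
      (#|gT|%:R^-1 + 'C(k, q)%:R * (q%:R / k%:R) ^+ (q + q)).
Proof.
move=> qk k0; set M := #|{ffun 'I_k -> gT}|%:R : R; set m := (q + q)%N.
have N0 : 0 < #|gT|%:R :> R by rewrite ltr0n; apply/card_gt0P; exists 1%g.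
have s0 : 0 < (2 * k)%:R ^+ m :> R by rewrite exprn_gt0 // ltr0n muln_gt0.
pose DD := finset.finset (fun D : {set 'I_k} => #|D| == q).
under eq_bigr do rewrite sym_gensE steps_kernel_words size_letters.
rewrite -mulr_suml exchange_big /= ler_pdivrMr //.
apply: (@le_trans _ _ (\sum_(w <- words letters m) (M / #|gT|%:R +
    \sum_(D in DD) M * (all (fun a : letter => a.1 \in D) w)%:R))).
  rewrite big_seq [leRHS]big_seq; apply: ler_sum => w /wordsP[sw _].
  under eq_bigr do rewrite mul1g.
  have [/existsP[i /eqP wi]|/existsPn w1] := boolP [exists i,
      count (fun a : letter => a.1 == i) w == 1%N].
    apply: (@le_trans _ _ (M / #|gT|%:R)).
      by rewrite ler_pdivlMr // mulrC (word_uniform wi).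
    by rewrite lerDl sumr_ge0 // => D _; rewrite mulr_ge0.
  have [D cD Dw] := word_few_indices qk sw w1.
  apply: (@le_trans _ _ M).
    apply: (@le_trans _ _ (\sum_(Z : {ffun 'I_k -> gT}) (1 : R))).
      by apply: ler_sum => Z _; case: eqP.
    by rewrite sumr_const.
  rewrite (bigD1 D) ?inE ?cD //= Dw mulr1 addrCA lerDl addr_ge0 //.
    by rewrite divr_ge0.
  by rewrite sumr_ge0 // => E _; rewrite mulr_ge0.
have -> : (2 * k)%:R ^+ m = \sum_(w <- words letters m) 1 :> R.
  by rewrite sum_words1 size_letters.
rewrite big_split /= mulrDr mulrDl; apply: lerD.
  by rewrite -mulrA mulr_sumr mulr_sumr; under [leRHS]eq_bigr do rewrite mulr1.
rewrite sum_words1 size_letters exchange_big /=.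
under eq_bigr do rewrite -mulr_sumr sum_words_all count_letters.
rewrite (eq_bigr (fun=> M * ((2 * q) ^ m)%:R)); last first.
  by move=> D; rewrite inE => /eqP ->.
have cDD : #|DD| = 'C(k, q) by have := card_draws 'I_k q; rewrite card_ord.
rewrite sumr_const cDD -[_ *+ _]mulr_natl mulrCA -!mulrA ler_wpM2l ?ler0n //.
rewrite ler_wpM2l ?ler0n // natrX -exprMn !natrM.
rewrite [X in _ <= X ^+ _](_ : _ = 2%:R * q%:R) //.
by field; rewrite pnatr_eq0 -lt0n.
Qed.

End RandomGenerators.

(** * From step counts to total variation in continuous time *)

Section TotalVariation.
Variables (R : realType) (gT : finGroupType) (S : seq gT).
Hypothesis S_gt0 : (0 < size S)%N.
Notation P := (steps_kernel R S).

Lemma sum_subset_le1 (A : {set gT}) (f : gT -> R) :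
  (forall y, 0 <= f y) -> \sum_y f y = 1 -> 0 <= \sum_(y in A) f y <= 1.
Proof.
move=> f0 f1; rewrite sumr_ge0 //= -f1 [leRHS](bigID (mem A)) /= lerDl.
exact: sumr_ge0.
Qed.

Lemma sum_unif : \sum_(y : gT) unif R y = 1.
Proof.
rewrite /unif sumr_const -[_ *+ _]mulr_natr mulVf // pnatr_eq0 -lt0n.
by apply/card_gt0P; exists 1%g.
Qed.

Lemma walk_kernel_setE (A : {set gT}) (t : R) x : 0 <= t ->
  \sum_(y in A) walk_kernel S t x y = pois_mix t (fun m => \sum_(y in A) P m x y).
Proof.
move=> t0; rewrite pois_mix_sum // => y; apply: is_cvg_pois_mix => // m.
by rewrite ger0_norm ?steps_kernel_ge0 ?steps_kernel_le1.
Qed.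

Lemma is_cvg_walk_set (A : {set gT}) (t : R) x : 0 <= t ->
  cvgn (series (fun m => pois t m * \sum_(y in A) P m x y)).
Proof.
move=> t0; apply: is_cvg_pois_mix => // m.
have /andP[p0 p1] := sum_subset_le1 A (steps_kernel_ge0 R S m x) (sum_steps_kernel R S_gt0 m x).
by rewrite ger0_norm.
Qed.

Lemma is_cvg_pois_event (t : R) (E : pred nat) : 0 <= t ->
  cvgn (series (fun m => pois t m * (E m)%:R)).
Proof.
by move=> t0; apply: is_cvg_pois_mix => // m; case: (E m); rewrite ?normr1 ?normr0.
Qed.

Lemma sum_walk_kernel_le1 (A : {set gT}) (t : R) x : 0 <= t ->
  0 <= \sum_(y in A) walk_kernel S t x y <= 1.
Proof.
move=> t0; rewrite walk_kernel_setE //.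
have B m := sum_subset_le1 A (steps_kernel_ge0 R S m x) (sum_steps_kernel R S_gt0 m x).
apply/andP; split.
  rewrite -[leLHS](pois_mix_cst t); apply: pois_mix_le => //.
  - exact: is_cvg_pois_cst.
  - exact: is_cvg_walk_set.
  - by move=> m; case/andP: (B m).
rewrite -[leRHS](pois_mix_cst t); apply: pois_mix_le => //.
- exact: is_cvg_walk_set.
- exact: is_cvg_pois_cst.
- by move=> m; case/andP: (B m).
Qed.

Lemma d_TV_le1 (t : R) : 0 <= t -> d_TV S t <= 1.
Proof.
move=> t0; apply/bigmax_leP; split => // x _; apply/bigmax_leP; split => // A _.
have /andP[a0 a1] := sum_walk_kernel_le1 A x t0.
have unif0 (y : gT) : 0 <= unif R y by rewrite invr_ge0.
have /andP[b0 b1] := sum_subset_le1 A unif0 sum_unif.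
rewrite ler_norml; lra.
Qed.

(** Split by the number of jumps: fewer than [m] cost at most 1, and from [m] on the l1 distance has
    not increased. *)
Lemma d_TV_le (t : R) m (e : R) : 0 <= t -> 0 <= e ->
  (forall x, l1_dist R S m x <= e) ->
  d_TV S t <= pois_mix t (fun j => (j < m)%:R) + e.
Proof.
move=> t0 e0 he; set tail := pois_mix t _.
have ct : cvgn (series (fun j => pois t j * (j < m)%:R)) by exact: is_cvg_pois_event.
have tail0 : 0 <= tail.
  rewrite -[leLHS](pois_mix_cst t); apply: pois_mix_le => //.
  exact: is_cvg_pois_cst.
apply/bigmax_leP; split => [|x _]; first by rewrite addr_ge0.
apply/bigmax_leP; split => [|A _]; first by rewrite addr_ge0.
set u := \sum_(y in A) unif R y.
have unif0 (y : gT) : 0 <= unif R y by rewrite invr_ge0.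
have /andP[u0 u1] := sum_subset_le1 A unif0 sum_unif.
rewrite walk_kernel_setE // -/u in u0 u1 *.
have B j := sum_subset_le1 A (steps_kernel_ge0 R S j x) (sum_steps_kernel R S_gt0 j x).
have dev j : `|\sum_(y in A) P j x y - u| <= (j < m)%:R + e.
  case: ltnP => [_|mj].
    by have /andP[p0 p1] := B j; rewrite ler_norml [true%:R]mulr1n; lra.
  rewrite add0r; apply: le_trans (he x).
  apply: le_trans (l1_dist_nincr R S_gt0 x mj).
  rewrite -sumrB; apply: le_trans (ler_norm_sum _ _ _) _.
  rewrite /l1_dist [leRHS](bigID (mem A)) /= lerDl.
  by rewrite sumr_ge0.
have cw := @is_cvg_walk_set A t x t0.
have cc := @is_cvg_pois_cst R t.
have cD := @is_cvg_pois_mixD R t.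
rewrite ler_norml lerBlDr lerBrDl; apply/andP; split.
  rewrite -[u](pois_mix_cst t) lerBlDr -[e in tail + e](pois_mix_cst t).
  rewrite -!pois_mixD //; last exact: (cD).
  apply: pois_mix_le => // [|j]; first by apply: (cD) => //; exact: (cD).
  by have := dev j; rewrite ler_norml; lra.
rewrite -[u](pois_mix_cst t) -[e in tail + e](pois_mix_cst t).
rewrite -!pois_mixD //; last exact: (cD).
apply: pois_mix_le => // [|j]; first by apply: (cD) => //; exact: (cD).
by have := dev j; rewrite ler_norml; lra.
Qed.

(** Test the event [B] for the walk from 1: after at most [m] jumps it surely lies in [B], whose
    uniform mass is [|B| / |G|]. *)
Lemma d_TV_ge (t : R) m (B : {set gT}) : 0 <= t ->
  (forall w : seq gT, (size w <= m)%N -> {subset w <= S} ->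
      (\prod_(a <- w) a)%g \in B) ->
  1 - pois_mix t (fun j => (m < j)%:R) - #|B|%:R / #|gT|%:R <= d_TV S t.
Proof.
move=> t0 hB; set tail := pois_mix t _.
have PB j : (j <= m)%N -> \sum_(y in B) P j 1%g y = 1.
  (* With [S] seen as [map id S] the word expansion applies. *)
  move=> jm; rewrite -[S]map_id.
  under eq_bigr do rewrite steps_kernel_words.
  rewrite -mulr_suml exchange_big /= -(sum_words1 R).
  have n0 : \sum_(w <- words S j) 1 != 0 :> R.
    by rewrite sum_words1 expf_neq0 // pnatr_eq0 -lt0n.
  rewrite -[RHS](divff n0); congr (_ / _).
  rewrite big_seq [RHS]big_seq; apply: eq_bigr => w /wordsP[sw wS].
  rewrite (bigD1 (\prod_(a <- w) a)%g) /=; last by rewrite hB // sw.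
  by rewrite mul1g eqxx big1 ?addr0 // => y /andP[_]; rewrite eq_sym => /negPf ->.
apply: le_trans (le_bigmax _ _ (1%g : gT)).
apply: le_trans (le_bigmax _ _ B).
apply: le_trans (ler_norm _).
have -> : \sum_(x in B) unif R x = #|B|%:R / #|gT|%:R.
  by rewrite /unif sumr_const -[LHS]mulr_natl.
rewrite lerD2r walk_kernel_setE // -(pois_mix1 t) /tail -pois_mixB //; first last.
- exact: is_cvg_pois_event.
- exact: is_cvg_pois_cst.
apply: pois_mix_le => //.
- rewrite (_ : (fun j => _) = fun j => pois t j * (j <= m)%:R).
    exact: is_cvg_pois_event.
  by apply/funext => j; case: leqP; rewrite ?subrr ?subr0.
- exact: is_cvg_walk_set.
move=> j; case: ltnP => [_|/PB ->]; last by rewrite subr0.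
rewrite subrr.
by case/andP: (sum_subset_le1 B (steps_kernel_ge0 R S j 1%g) (sum_steps_kernel R S_gt0 j 1%g)).
Qed.

End TotalVariation.

(** * Markov's inequality over the generators *)

Section RandomUpperBound.
Variables (R : realType) (gT : finGroupType) (k : nat).
Notation gens := {ffun 'I_k -> gT}.

Lemma iid_unif_probE (E : pred gens) :
  iid_unif_prob R E = (\sum_(Z | E Z) 1) / #|gens|%:R.
Proof.
rewrite /iid_unif_prob mulr_suml; apply: eq_bigr => Z _; rewrite mul1r.
by rewrite prodr_const card_ord card_ffun card_ord natrX exprVn.
Qed.

Lemma iid_unif_prob_ge0 (E : pred gens) : 0 <= iid_unif_prob R E.
Proof. by apply: sumr_ge0 => Z _; apply: prodr_ge0 => i _; rewrite invr_ge0. Qed.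

Lemma iid_unif_prob0 (E : pred gens) : (forall Z, ~~ E Z) -> iid_unif_prob R E = 0.
Proof. by move=> E0; rewrite /iid_unif_prob big_pred0 //= => Z; exact: negbTE (E0 Z). Qed.

(** Left translation cancels, so a single return probability controls all starting points in the
    maximum of [d_TV]. *)
Lemma return_prob_transl m (Z : gens) x :
  steps_kernel R (sym_gens Z) m x x = steps_kernel R (sym_gens Z) m 1%g 1%g.
Proof.
rewrite sym_gensE !steps_kernel_words; congr (_ / _); apply: eq_bigr => w _.
by rewrite mul1g -[in RHS](inj_eq (mulgI x)) mulg1.
Qed.

(** Markov's inequality for [X], nonnegative as [|G|] times a sum of squares. With [c = delta / 2],
    [X <= c^2] bounds the l1 distance by [c/2 + c/2], and the Poisson tail takes the other half of
    [delta]. *)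
Lemma prob_d_TV_gt (t delta : R) q : (0 < k)%N -> (q <= k)%N -> 0 <= t -> 0 < delta ->
  pois_mix t (fun j => (j < q)%:R) <= delta / 2 ->
  iid_unif_prob R (fun Z : gens => delta < `|d_TV (sym_gens Z) t - 0|) <=
    #|gT|%:R * ('C(k, q)%:R * (q%:R / k%:R) ^+ (q + q)) / (delta / 2) ^+ 2.
Proof.
move=> k0 qk t0 d0 tail; set c := delta / 2.
have c0 : 0 < c by rewrite divr_gt0.
have N0 : 0 < #|gT|%:R :> R by rewrite ltr0n; apply/card_gt0P; exists 1%g.
have M0 : 0 < #|gens|%:R :> R.
  by rewrite ltr0n; apply/card_gt0P; exists [ffun=> 1%g].
have S0 (Z : gens) : (0 < size (sym_gens Z))%N by rewrite size_sym_gens muln_gt0.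
pose X (Z : gens) : R := #|gT|%:R * steps_kernel R (sym_gens Z) (q + q) 1%g 1%g - 1.
have X0 Z : 0 <= X Z.
  have := sum_sqr_dev R (S0 Z) (sym_gens_inv Z) q 1%g => h.
  have -> : X Z = #|gT|%:R * (\sum_y (steps_kernel R (sym_gens Z) q 1%g y - unif R y) ^+ 2).
    by rewrite h mulrBr mulfV ?gt_eqF.
  apply: mulr_ge0; first exact: ltW.
  by apply: sumr_ge0 => y _; exact: sqr_ge0.
have good Z : X Z <= c ^+ 2 -> d_TV (sym_gens Z) t <= delta.
  move=> Xc; apply: (@le_trans _ _ (pois_mix t (fun j => (j < q)%:R) + c)).
    apply: d_TV_le => //; first exact: ltW.
    move=> x; apply: le_trans (l1_dist_le (S0 Z) (sym_gens_inv Z) q x c0) _.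
    rewrite return_prob_transl -/(X Z).
    have : X Z / (2 * c) <= c ^+ 2 / (2 * c).
      by rewrite ler_pM2r // invr_gt0 mulr_gt0.
    have -> : c ^+ 2 / (2 * c) = c / 2 by field; rewrite gt_eqF.
    lra.
  by rewrite /c in tail *; lra.
rewrite iid_unif_probE.
(* On the bad event [X > c^2], so its indicator is at most [X / c^2]. *)
apply: (@le_trans _ _ ((\sum_Z X Z / c ^+ 2) / #|gens|%:R)).
  rewrite ler_pM2r ?invr_gt0 // [leLHS]big_mkcond; apply: ler_sum => Z _.
  case: ifPn => [|_]; last by rewrite divr_ge0 ?sqr_ge0.
  rewrite subr0 => bad; rewrite ler_pdivlMr ?exprn_gt0 // mul1r leNgt.
  apply/negP => /ltW /good; apply/negP; rewrite -ltNge.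
  by rewrite -[ltRHS]ger0_norm // /d_TV; apply: bigmax_ge_id.
rewrite -mulr_suml mulrAC ler_pM2r ?invr_gt0 ?exprn_gt0 // ler_pdivrMr //.
rewrite sumrB -mulr_sumr sumr_const.
have := sum_return_prob R gT qk k0; rewrite -(ler_pM2l N0) => /le_trans h.
rewrite lerBlDr; apply: h.
by rewrite le_eqVlt; apply/orP; left; apply/eqP; field; rewrite gt_eqF.
Qed.

End RandomUpperBound.

(** * Binomial estimates *)

Section Estimates.
Variable R : realType.

Lemma expr_fact_le (x : R) n : 0 <= x -> x ^+ n / n`!%:R <= expR x.
Proof.
case: n => [|n] x0; first by rewrite expr0 fact0 divr1 -{1}expR0 ler_expR.
by apply: le_trans (expR_ge1Dxn n x0); rewrite lerDr.
Qed.

Lemma ffact_le_expn n m : (n ^_ m <= n ^ m)%N.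
Proof.
elim: m n => [|m IH] n; first by rewrite ffactn0.
rewrite ffactnS expnS leq_mul //; apply: leq_trans (IH _) _.
by case: m {IH} => [//|m]; rewrite leq_exp2r ?leq_pred.
Qed.

(** Combines ['C(n, m) <= n^m / m!] with [x^m / m! <= e^x]. The free [x] is [q] in the upper bound
    and [t0] in the lower bound. *)
Lemma bin_le_expR n m (x : R) : 0 < x ->
  'C(n, m)%:R <= (n%:R / x) ^+ m * expR x :> R.
Proof.
move=> x0; apply: (@le_trans _ _ (n%:R ^+ m / m`!%:R)).
  by rewrite ler_pdivlMr ?ltr0n ?fact_gt0 // -natrM -natrX ler_nat bin_ffact ffact_le_expn.
rewrite expr_div_n -mulrA ler_wpM2l ?exprn_ge0 //.
rewrite -ler_pdivrMl ?invr_gt0 ?exprn_gt0 // invrK.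
exact: expr_fact_le (ltW x0).
Qed.

Lemma bin_few_indices k q : (0 < k)%N ->
  'C(k, q)%:R * (q%:R / k%:R) ^+ (q + q) <= (expR 1 * q%:R / k%:R) ^+ q :> R.
Proof.
move=> k0; have [->|q0] := posnP q; first by rewrite bin0 !expr0 mulr1.
have k0' : 0 < k%:R :> R by rewrite ltr0n.
have q0' : 0 < q%:R :> R by rewrite ltr0n.
apply: (@le_trans _ _ ((k%:R / q%:R) ^+ q * expR q%:R * (q%:R / k%:R) ^+ (q + q))).
  by rewrite ler_wpM2r ?exprn_ge0 ?divr_ge0 // bin_le_expR.
rewrite -[expR q%:R](_ : expR 1 ^+ q = _); last by rewrite -expRM_natl mulr1.
rewrite exprD -!exprMn le_eqVlt; apply/orP; left; apply/eqP.
by congr (_ ^+ q); field; rewrite !gt_eqF.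
Qed.

End Estimates.

(** * Exponents and asymptotic scales *)

Section Asymptotics.
Variable R : realType.
Implicit Types (eps l kappa : R).

(** Here [l] stands for [ln |G|]. Since [t0 / k = 1 / (L e^L)], the assumption on [L] absorbs the
    factor [e (1 + eps)] and the base is at most [e^(-L)]. As [L t0 = l], its power is at most
    [e^(-(1 + eps/2) l)], which beats [e^l]. *)
Lemma upper_exponent eps l (k q : nat) : 0 < eps -> 0 < l -> (0 < k)%N ->
  let L := ln (k%:R / l) in let t0 := l / L in
  expR 1 * (1 + eps) <= L -> (1 + eps / 2) * t0 <= q%:R <= (1 + eps) * t0 ->
  (q <= k)%N /\ expR l * (expR 1 * q%:R / k%:R) ^+ q <= expR (- (eps / 2 * l)).
Proof.
move=> e0 l0 k0 L t0 hL /andP[hq1 hq2].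
have E1 : 1 <= expR 1 :> R by rewrite -{1}expR0 ler_expR.
have L0 : 0 < L by apply: lt_le_trans hL; rewrite mulr_gt0 ?expR_gt0 // addr_gt0.
have k0' : 0 < k%:R :> R by rewrite ltr0n.
have kap0 : 0 < k%:R / l by rewrite divr_gt0.
have kapE : expR L = k%:R / l by rewrite lnK ?posrE.
have tk : t0 / k%:R = (L * expR L)^-1.
  by rewrite kapE /t0; field; rewrite !gt_eqF.
have qk : expR 1 * q%:R / k%:R <= expR (- L).
  apply: (@le_trans _ _ (expR 1 * ((1 + eps) * t0) / k%:R)).
    by rewrite ler_pM2r ?invr_gt0 // ler_pM2l ?expR_gt0.
  have -> : expR 1 * ((1 + eps) * t0) / k%:R = expR 1 * (1 + eps) * (t0 / k%:R) by ring.
  rewrite tk invfM mulrA expRN ler_piMl ?invr_ge0 ?expR_ge0 //.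
  by rewrite ler_pdivrMr // mul1r.
split.
  have : q%:R / k%:R <= (1 : R).
    apply: (@le_trans _ _ (expR 1 * q%:R / k%:R)).
      by rewrite ler_pM2r ?invr_gt0 // ler_peMl.
    apply: le_trans qk _; rewrite -expR0 ler_expR; lra.
  by rewrite ler_pdivrMr // mul1r ler_nat.
apply: (@le_trans _ _ (expR l * expR (- L) ^+ q)).
  rewrite ler_pM2l ?expR_gt0 //; apply: lerXn2r; rewrite ?nnegrE ?expR_ge0 //.
rewrite -expRM_natl -expRD ler_expR.
have : L * ((1 + eps / 2) * t0) <= L * q%:R by rewrite ler_pM2l.
have -> : L * ((1 + eps / 2) * t0) = (1 + eps / 2) * l.
  by rewrite /t0; field; rewrite gt_eqF.
lra.
Qed.

(** Take [x = t0] in [bin_le_expR]: the base [n / t0 <= D L e^L] is at most [e^((1 + eps/4) L)], and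
    the total exponent is at most [(1 + eps/4) (1 - eps/2) l + (eps/8) l <= (1 - eps/8) l]. *)
Lemma lower_exponent eps l (D : R) (k m n : nat) : 0 < eps -> 0 < l -> (0 < k)%N -> 1 <= D ->
  let L := ln (k%:R / l) in let t0 := l / L in
  8 / eps <= L -> 2 * D / (eps / 4) ^+ 2 <= L ->
  m%:R <= (1 - eps / 2) * t0 -> n%:R <= D * k%:R ->
  'C(n, m)%:R <= expR ((1 - eps / 8) * l).
Proof.
move=> e0 l0 k0 D1 L t0 hL1 hL2 hm hn.
have L0 : 0 < L by apply: lt_le_trans hL1; rewrite divr_gt0.
have t00 : 0 < t0 by rewrite divr_gt0.
have k0' : 0 < k%:R :> R by rewrite ltr0n.
have kapE : expR L = k%:R / l by rewrite lnK ?posrE // divr_gt0.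
(* The quadratic term of the exponential series already dominates [D * L], by the second assumption
   on [L]. *)
have DL : D * L <= expR (eps / 4 * L).
  have e4 : 0 < (eps / 4) ^+ 2 by rewrite exprn_gt0 // divr_gt0.
  have el : 0 <= eps / 4 * L by rewrite mulr_ge0 ?ltW // divr_gt0.
  apply: le_trans (expr_fact_le 2 el).
  rewrite ler_pdivlMr // (_ : (_ * _) ^+ 2 = L * (eps / 4) ^+ 2 * L); last by ring.
  move: hL2; rewrite ler_pdivrMr // => h.
  have : 2 * D * L <= L * (eps / 4) ^+ 2 * L by rewrite ler_pM2r.
  rewrite (_ : (2`!)%:R = 2 :> R) //; lra.
apply: le_trans (bin_le_expR n m t00) _.
have nt : n%:R / t0 <= expR ((1 + eps / 4) * L).
  apply: (@le_trans _ _ (D * k%:R / t0)); first by rewrite ler_pM2r ?invr_gt0.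
  have -> : D * k%:R / t0 = D * L * expR L.
    by rewrite kapE /t0; field; rewrite !gt_eqF.
  by rewrite mulrDl mul1r expRD mulrC ler_pM2l ?expR_gt0.
apply: (@le_trans _ _ (expR ((1 + eps / 4) * L) ^+ m * expR t0)).
  rewrite ler_pM2r ?expR_gt0 //; apply: lerXn2r; rewrite ?nnegrE ?expR_ge0 //.
  by rewrite divr_ge0 // ltW.
rewrite -expRM_natl -expRD ler_expR.
have h1 : (1 + eps / 4) * L * m%:R <= (1 + eps / 4) * L * ((1 - eps / 2) * t0).
  by rewrite ler_pM2l // mulr_gt0 // addr_gt0 ?divr_gt0.
have h2 : (1 + eps / 4) * L * ((1 - eps / 2) * t0) = (1 + eps / 4) * (1 - eps / 2) * l.
  by rewrite /t0; field; rewrite gt_eqF.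
(* [8 / eps <= L] makes the factor [expR t0] cost only [eps / 8 * l] in the exponent. *)
have h3 : t0 <= eps / 8 * l.
  have : l * 1 <= l * (eps / 8 * L).
    by rewrite ler_pM2l //; move: hL1; rewrite ler_pdivrMr //; lra.
  by rewrite /t0 ler_pdivrMr //; lra.
have h4 : 0 <= eps ^+ 2 * l by rewrite mulr_ge0 ?sqr_ge0 // ltW.
nra.
Qed.

Lemma near_expR_le (f : nat -> R) (c e : R) : f @ \oo --> +oo -> 0 < c -> 0 < e ->
  \forall n \near \oo, expR (- (c * f n)) <= e.
Proof.
move=> /cvgryPge foo c0 e0; near=> n.
have : - ln e / c <= f n by near: n; exact: foo.
rewrite ler_pdivrMr // => h; rewrite -[leRHS]lnK ?posrE // ler_expR; lra.
Unshelve. all: by end_near. Qed.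

Section Scales.
Variables (N k : nat -> nat).
Hypothesis N_oo : N @ \oo --> \oo.
Hypothesis k_large : asymp_ll (fun n => ln (N n)%:R : R) (fun n => (k n)%:R).
Hypothesis log_k_small :
  asymp_ll (fun n => ln (k n)%:R : R) (fun n => ln (N n)%:R).

Lemma cvg_ln_card : (ln (N n)%:R : R) @[n --> \oo] --> (+oo : set_system R).
Proof.
apply/cvgryPge => A; near=> n.
rewrite -[leLHS]expRK; have h : expR A <= (N n)%:R.
  near: n; move/cvgnyPge: N_oo => /(_ (Num.truncn (expR A)).+1).
  apply: filterS => n h; apply: ltW; apply: lt_le_trans (truncnS_gt _) _.
  by rewrite ler_nat.
by rewrite ler_ln ?posrE ?expR_gt0 //; apply: lt_le_trans h; exact: expR_gt0.
Unshelve. all: by end_near. Qed.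

Let ln_card_ge (A : R) : \forall n \near \oo, A <= ln (N n)%:R.
Proof. by move: cvg_ln_card => /cvgryPge; exact. Qed.

Lemma near_k_gt0 : \forall n \near \oo, (0 < k n)%N.
Proof. by case: k_large => + _; apply: filterS => n; rewrite pnatr_eq0 -lt0n. Qed.

Lemma cvg_ratio : ((k n)%:R / ln (N n)%:R : R) @[n --> \oo] --> (+oo : set_system R).
Proof.
(* [Num.max A 1] is positive, so the bound can be inverted for every [A]. *)
apply/cvgryPge => A; case: k_large => _ /cvgrPdist_le /(_ (Num.max A 1)^-1) h.
have A0 : 0 < (Num.max A 1)^-1 by rewrite invr_gt0 lt_max ltr01 orbT.
near=> n.
have l1 : 1 <= ln (N n)%:R :> R by near: n; exact: ln_card_ge.
have l0 : 0 < ln (N n)%:R :> R := lt_le_trans ltr01 l1.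
have k0 : 0 < (k n)%:R :> R by rewrite ltr0n; near: n; exact: near_k_gt0.
have : ln (N n)%:R / (k n)%:R <= (Num.max A 1)^-1 :> R.
  have : `|0 - ln (N n)%:R / (k n)%:R| <= (Num.max A 1)^-1 :> R by near: n; exact: h.
  by apply: le_trans; rewrite sub0r normrN ler_norm.
rewrite -invf_div lef_pV2 ?posrE.
- by move=> h1; apply: le_trans h1; rewrite le_max lexx.
- by rewrite divr_gt0.
- by rewrite -invr_gt0.
Unshelve. all: by end_near. Qed.

Lemma cvg_ln_ratio : ln ((k n)%:R / ln (N n)%:R : R) @[n --> \oo] --> (+oo : set_system R).
Proof.
apply/cvgryPge => A; move: cvg_ratio => /cvgryPge /(_ (expR A)); apply: filterS => n h.
by rewrite -[leLHS]expRK ler_ln ?posrE ?expR_gt0 //; apply: lt_le_trans h; exact: expR_gt0.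
Qed.

(** Once [ln N >= 1], [ln (k / ln N) <= ln k], so the time is at least [ln N / ln k]. Its divergence
    makes the Poisson number of jumps concentrate. *)
Lemma cvg_cutoff_time : cutoff_time R (k n) (N n) @[n --> \oo] --> (+oo : set_system R).
Proof.
apply/cvgryPge => A; case: log_k_small => _ /cvgrPdist_le /(_ (Num.max A 1)^-1) h.
have A0 : 0 < (Num.max A 1)^-1 by rewrite invr_gt0 lt_max ltr01 orbT.
near=> n.
have l1 : 1 <= ln (N n)%:R :> R by near: n; exact: ln_card_ge.
have l0 : 0 < ln (N n)%:R :> R := lt_le_trans ltr01 l1.
have k0 : 0 < (k n)%:R :> R by rewrite ltr0n; near: n; exact: near_k_gt0.
have r1 : 1 <= ln ((k n)%:R / ln (N n)%:R : R).
  by near: n; move: cvg_ln_ratio => /cvgryPge; exact.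
have r0 := lt_le_trans ltr01 r1.
have rk : ln ((k n)%:R / ln (N n)%:R : R) <= ln (k n)%:R.
  by rewrite ler_ln ?posrE ?divr_gt0 // ler_pdivrMr // ler_peMr // ltW.
have : ln (k n)%:R / ln (N n)%:R <= (Num.max A 1)^-1 :> R.
  have : `|0 - ln (k n)%:R / ln (N n)%:R| <= (Num.max A 1)^-1 :> R by near: n; exact: h.
  by apply: le_trans; rewrite sub0r normrN ler_norm.
have lk0 : 0 < ln (k n)%:R :> R by exact: lt_le_trans rk.
rewrite -invf_div lef_pV2 ?posrE.
- move=> h1; apply: (@le_trans _ _ (ln (N n)%:R / ln (k n)%:R)).
    by apply: le_trans h1; rewrite le_max lexx.
  by rewrite /cutoff_time ler_pM2l // lef_pV2 ?posrE.
- by rewrite divr_gt0.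
- by rewrite -invr_gt0.
Unshelve. all: by end_near. Qed.

End Scales.
End Asymptotics.

(** * Both halves of the cutoff, with thresholds fixed for large [n] *)

Theorem theorem1p4 (R : realType) (gT : nat -> finGroupType)
    (H : forall n, {group gT n}) (k : nat -> nat)
    (card_G : (fun n => #|gT n|) @ \oo --> \oo)
    (H_normal : forall n, normal (H n) [set: gT n]%G)
    (H_abelian : forall n, abelian (H n))
    (H_index : has_ubound (range (fun n => #|gT n|%:R / #|H n|%:R : R)))
    (k_large : asymp_ll (fun n => ln #|gT n|%:R : R) (fun n => (k n)%:R))
    (log_k_small :
      asymp_ll (fun n => ln (k n)%:R : R) (fun n => ln #|gT n|%:R)) :
  cutoff_whp gT k (fun n => cutoff_time R (k n) #|gT n|).
Proof.
have card_oo := @cvg_ln_card R _ card_G.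
have ratio_oo := cvg_ratio card_G k_large.
have lnr_oo := cvg_ln_ratio card_G k_large.
have time_oo := cvg_cutoff_time card_G k_large log_k_small.
have k_gt0 := near_k_gt0 k_large.
have card_ge (A : R) : \forall n \near \oo, A <= ln #|gT n|%:R.
  by move: card_oo => /cvgryPge; exact.
have ratio_ge (A : R) : \forall n \near \oo, A <= (k n)%:R / ln #|gT n|%:R.
  by move: ratio_oo => /cvgryPge; exact.
have lnr_ge (A : R) : \forall n \near \oo, A <= ln ((k n)%:R / ln #|gT n|%:R).
  by move: lnr_oo => /cvgryPge; exact.
have time_ge (A : R) : \forall n \near \oo, A <= cutoff_time R (k n) #|gT n|.
  by move: time_oo => /cvgryPge; exact.
have cardE n : expR (ln #|gT n|%:R) = #|gT n|%:R :> R.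
  by rewrite lnK // posrE ltr0n; apply/card_gt0P; exists 1%g.
move=> eps e0; split=> [e1|] delta d0; apply/cvgrPdist_le => e ee.
- case: H_index => L ubL.
  have idxL n : #|[set: gT n]%G : H n|%g%:R <= L :> R.
    apply: ubL; exists n => //.
    by rewrite -divgS ?finset.subsetT // natf_div ?cardSg ?finset.subsetT // cardsT.
  have L1 : 1 <= L.
    by apply: le_trans (idxL 0); rewrite ler1n indexg_gt0.
  have D1 : 1 <= 2 * L + 2 by lra.
  (* The ratio of the step threshold [(1 - eps/2) t0] to the Poisson mean [(1 - eps) t0]; being
     above 1, it tilts towards large counts. *)
  pose q := (1 - eps / 2) / (1 - eps).
  have q1 : 1 < q by rewrite /q ltr_pdivlMr; lra.
  have q0 : 0 < q by lra.
  have rate0 : 0 < tilt_rate q by rewrite tilt_rate_gt0 // gt_eqF.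
  have ce0 : 0 < tilt_rate q * (1 - eps) by rewrite mulr_gt0 // subr_gt0.
  have de : 0 < delta / 2 / L by rewrite !divr_gt0 //; lra.
  near=> n.
  have t1 : 1 <= cutoff_time R (k n) #|gT n| by near: n; exact: time_ge.
  have l1 : 1 <= ln #|gT n|%:R :> R by near: n; exact: card_ge.
  have kn0 : (0 < k n)%N by near: n.
  have k1 : 1 <= (k n)%:R :> R by rewrite ler1n.
  have r1 : 1 <= (k n)%:R / ln #|gT n|%:R :> R by near: n; exact: ratio_ge.
  have h1 : 1 <= ln ((k n)%:R / ln #|gT n|%:R) :> R by near: n; exact: lnr_ge.
  have h2 : 8 / eps <= ln ((k n)%:R / ln #|gT n|%:R) by near: n; exact: lnr_ge.
  have h3 : 2 * (2 * L + 2) / (eps / 4) ^+ 2 <= ln ((k n)%:R / ln #|gT n|%:R).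
    by near: n; exact: lnr_ge.
  have h4 : expR (- (tilt_rate q * (1 - eps) * cutoff_time R (k n) #|gT n|)) <= delta / 2.
    by near: n; apply: near_expR_le => //; rewrite divr_gt0.
  have h5 : expR (- (eps / 8 * ln #|gT n|%:R)) <= delta / 2 / L.
    by near: n; apply: near_expR_le => //; rewrite divr_gt0.
  set t0 := cutoff_time _ _ _ in t1 h4 *.
  have l0 : 0 < ln #|gT n|%:R :> R by exact: lt_le_trans l1.
  have t00 : 0 < t0 by exact: lt_le_trans t1.
  have x0 : 0 <= (1 - eps / 2) * t0 by rewrite mulr_ge0; lra.
  set m := Num.truncn ((1 - eps / 2) * t0).
  have /andP[mle mgt] : m%:R <= (1 - eps / 2) * t0 < m.+1%:R by exact: truncn_itv.
  have tl : t0 <= ln #|gT n|%:R.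
    by rewrite /t0 /cutoff_time ler_pdivrMr ?(lt_le_trans ltr01) // ler_peMr // ltW.
  have lk : ln #|gT n|%:R <= (k n)%:R :> R.
    by move: r1; rewrite ler_pdivlMr // mul1r.
  have tt0 : 0 < (1 - eps) * t0 by rewrite mulr_gt0 // subr_gt0.
  (* For such [n] no choice of generators lies in the exceptional event, so its probability is
     exactly 0. *)
  rewrite sub0r normrN iid_unif_prob0 ?normr0 ?ltW // => Z; rewrite -leNgt.
  have S0 : (0 < size (sym_gens Z))%N by rewrite size_sym_gens muln_gt0.
  have [B [hB cB]] := short_words_card (sym_gens Z) m (H_abelian n).
  have ge := d_TV_ge S0 (ltW tt0) hB.
  have le := d_TV_le1 S0 (ltW tt0).
  have tail : pois_mix ((1 - eps) * t0) (fun j => (m < j)%:R) <= delta / 2.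
    apply: le_trans h4; rewrite -mulrA; apply: pois_tail => // j mj.
    rewrite mulr_ge0 ?ln_ge0 //; last exact: ltW.
    have -> : q * ((1 - eps) * t0) = (1 - eps / 2) * t0.
      by rewrite /q; field; rewrite subr_eq0 gt_eqF.
    by rewrite subr_ge0 (le_trans (ltW mgt)) // ler_nat.
  have small : #|B|%:R / #|gT n|%:R <= delta / 2.
    set idx := #|[set: gT n]%G : H n|%g in cB.
    have cB' : #|B|%:R <= idx%:R * 'C(m + (idx * size (sym_gens Z)).+1, m)%:R :> R.
      by rewrite -natrM ler_nat.
    (* The [2k] generators give [2 * L]; the remaining [2] covers [m <= t0 <= ln |G| <= k] and the
       extra 1. *)
    have nD : (m + (idx * size (sym_gens Z)).+1)%:R <= (2 * L + 2) * (k n)%:R :> R.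
      rewrite size_sym_gens natrD -addn1 natrD !natrM.
      have a1 : idx%:R * (2 * (k n)%:R) <= L * (2 * (k n)%:R) :> R.
        by rewrite ler_wpM2r // idxL.
      have a2 : (1 - eps / 2) * t0 <= 1 * t0 by rewrite ler_pM2r //; lra.
      lra.
    have bC := lower_exponent e0 l0 kn0 D1 h2 h3 mle nD.
    have N0 : 0 < #|gT n|%:R :> R by rewrite -cardE expR_gt0.
    (* Dividing by [|G|] leaves [L] times [expR (- (eps / 8 * ln |G|))], at most [delta / 2] by
       [h5]. *)
    apply: (@le_trans _ _ (L * expR ((1 - eps / 8) * ln #|gT n|%:R) / #|gT n|%:R)).
      rewrite ler_pM2r ?invr_gt0 //; apply: le_trans cB' _.
      by apply: ler_pM => //; exact: idxL.
    rewrite -[in _ / #|gT n|%:R]cardE -mulrA -expRN -expRD.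
    rewrite mulrC -ler_pdivlMr ?(lt_le_trans ltr01) //; apply: le_trans h5.
    by rewrite expRK ler_expR; lra.
  rewrite ler0_norm; lra.
(* The same ratio for the upper half is below 1, so the tilt now controls small counts. *)
- pose q := (1 + eps / 2) / (1 + eps).
  have q0 : 0 < q by rewrite divr_gt0; lra.
  have q1 : q < 1 by rewrite /q ltr_pdivrMr; lra.
  have rate0 : 0 < tilt_rate q by rewrite tilt_rate_gt0 // lt_eqF.
  have ce0 : 0 < tilt_rate q * (1 + eps) by rewrite mulr_gt0 //; lra.
  have d2 : 0 < delta / 2 by rewrite divr_gt0.
  have ed : 0 < e * (delta / 2) ^+ 2 by rewrite mulr_gt0 ?exprn_gt0.
  near=> n.
  have t1 : 1 <= cutoff_time R (k n) #|gT n| by near: n; exact: time_ge.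
  have t2 : 2 / eps <= cutoff_time R (k n) #|gT n| by near: n; exact: time_ge.
  have l1 : 1 <= ln #|gT n|%:R :> R by near: n; exact: card_ge.
  have l0 : 0 < ln #|gT n|%:R :> R by exact: lt_le_trans l1.
  have kn0 : (0 < k n)%N by near: n.
  have h1 : expR 1 * (1 + eps) <= ln ((k n)%:R / ln #|gT n|%:R).
    by near: n; exact: lnr_ge.
  have h4 : expR (- (tilt_rate q * (1 + eps) * cutoff_time R (k n) #|gT n|)) <= delta / 2.
    by near: n; exact: near_expR_le.
  have h5 : expR (- (eps / 2 * ln #|gT n|%:R)) <= e * (delta / 2) ^+ 2.
    by near: n; apply: near_expR_le => //; rewrite divr_gt0.
  set t0 := cutoff_time _ _ _ in t1 t2 h4 *.
  have t00 : 0 < t0 by exact: lt_le_trans t1.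
  have tt0 : 0 < (1 + eps) * t0 by rewrite mulr_gt0 // addr_gt0.
  have x0 : 0 <= (1 + eps / 2) * t0 by rewrite mulr_ge0; lra.
  (* Rounded up, so that [m] exceeds [(1 + eps/2) t0] while [j < m] still forces
     [j <= (1 + eps/2) t0]. *)
  set m := (Num.truncn ((1 + eps / 2) * t0)).+1.
  have /andP[mle mgt] : m.-1%:R <= (1 + eps / 2) * t0 < m%:R by exact: truncn_itv.
  have mE : m%:R = m.-1%:R + 1 :> R by rewrite -natr1.
  (* [t0 >= 2 / eps] leaves room of at least 1 for the rounding. *)
  have mup : m%:R <= (1 + eps) * t0.
    by move: t2; rewrite ler_pdivrMr // mE; lra.
  have [|mk bound] := upper_exponent (q := m) e0 l0 kn0 h1.
    by rewrite (ltW mgt) mup.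
  have tail : pois_mix ((1 + eps) * t0) (fun j => (j < m)%:R) <= delta / 2.
    apply: le_trans h4; rewrite -mulrA; apply: pois_tail => // j jm.
    rewrite mulr_le0 ?ln_le0 //; last exact: ltW.
    have -> : q * ((1 + eps) * t0) = (1 + eps / 2) * t0.
      by rewrite /q; field; rewrite gt_eqF // addr_gt0.
    by rewrite subr_le0 (le_trans _ mle) // ler_nat.
  rewrite sub0r normrN ger0_norm ?iid_unif_prob_ge0 //.
  apply: le_trans (prob_d_TV_gt (gT n) kn0 mk (ltW tt0) d0 tail) _.
  rewrite ler_pdivrMr ?exprn_gt0 //; apply: le_trans h5; apply: le_trans bound.
  by rewrite cardE ler_pM2l ?bin_few_indices // -cardE expR_gt0.
Unshelve. all: by end_near. Qed.
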